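(* There is a choice $k = \tilde{O}(1/\epsilon)$ such that the following randomized algorithm (the edge-sampling test) is a one-sided tester for odd-cycle-freeness with query complexity $\tilde{O}(1/\epsilon^2)$. Given $\epsilon \in (0,1)$ and oracle access to $f:\mathbb{F}_2^n\to\{0,1\}$: pick $\alpha_1,\ldots,\alpha_k\in\mathbb{F}_2^n$ independently and uniformly at random, let $G=\{\alpha_i-\alpha_j : i<j\}$, query $f$ on all points of $G$, and accept if and only if the restriction of $f$ to $G$ is odd-cycle-free, i.e. there are no odd $m\ge 1$ and $x_1,\ldots,x_m\in G$ with $f(x_1)=\cdots=f(x_m)=1$ and $x_1+\cdots+x_m=0$. That is: every odd-cycle-free $f$ is accepted with probability $1$, and every $f$ that is $\epsilon$-far from odd-cycle-free is rejected with probability at least $2/3$.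
   Context: A function $f:\mathbb{F}_2^n\to\{0,1\}$ is odd-cycle-free (OCF) if for every odd $k\ge 1$ there are no $x_1,\ldots,x_k\in\mathbb{F}_2^n$ with $x_1+\cdots+x_k=0$ and $f(x_i)=1$ for all $i$. The distance between $f,g:\mathbb{F}_2^n\to\{0,1\}$ is $\delta(f,g)=\Pr_x[f(x)\ne g(x)]$ for uniform $x$; the distance of $f$ from OCF is $\min\{\delta(f,g): g \text{ OCF}\}$, and $f$ is $\epsilon$-far from OCF if this distance is at least $\epsilon$. Query complexity is the number of evaluations of $f$. *)

(* Defs.v *)
From HB Require Import structures.
From mathcomp Require Import all_boot all_order all_algebra.
From mathcomp Require Import boolp reals exp.

Set Implicit Arguments.
Unset Strict Implicit.
Unset Printing Implicit Defensive.

Import Order.TTheory GRing.Theory Num.Theory.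
Local Open Scope ring_scope.

Notation F2vec n := 'rV['F_2]_n.
Notation boolfun n := {ffun F2vec n -> bool}.

Definition Pr (R : realType) (T : finType) (E : pred T) : R :=
  #|E|%:R / #|T|%:R.

Definition ocf_on (n : nat) (A : {set F2vec n}) (f : boolfun n) : Prop :=
  forall (m : nat) (x : 'I_m -> F2vec n), odd m ->
    ~ [/\ forall i, x i \in A, forall i, f (x i) = true & \sum_(i < m) x i = 0].

Definition OCF (n : nat) (f : boolfun n) : Prop := ocf_on [set: F2vec n] f.

Definition fdist (R : realType) (n : nat) (f g : boolfun n) : R :=
  Pr R [pred x : F2vec n | f x != g x].

(* The default value 1 never matters: fdist is at most 1 and the zero function
   is odd-cycle-free. *)
Definition dist_OCF (R : realType) (n : nat) (f : boolfun n) : R :=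
  \big[Num.min/1]_(g : boolfun n | `[< OCF g >]) fdist R f g.

Definition eps_far (R : realType) (n : nat) (eps : R) (f : boolfun n) : Prop :=
  eps <= dist_OCF R f.

(* The seed of the test: k independent uniform vectors, i.e. a uniform element
   of this finite type. *)
Notation seed k n := {ffun 'I_k -> F2vec n}.

Definition edge_queries (k n : nat) (alpha : seed k n) : {set F2vec n} :=
  [set alpha p.1 - alpha p.2 | p : 'I_k * 'I_k & (p.1 < p.2)%N].

Definition edge_accepts (k n : nat) (f : boolfun n) (alpha : seed k n) : bool :=
  `[< ocf_on (edge_queries alpha) f >].

(* Worst case over the seed; the queries are non-adaptive and do not depend
   on f. *)
Definition query_complexity (k n : nat) : nat :=
  (\max_(alpha : seed k n) #|edge_queries alpha|)%N.

(* h = O(g * polylog g), uniformly for eps in (0,1), where g >= 1 there.  The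
   1 + keeps the logarithmic factor away from 0 as eps tends to 1. *)
Definition soft_O (R : realType) (h : R -> nat) (g : R -> R) : Prop :=
  exists (C : R) (c : nat), forall eps : R, 0 < eps < 1 ->
    (h eps)%:R <= C * (g eps * (1 + ln (g eps)) ^+ c).

(* Main.v *)
Require Import Defs.
From HB Require Import structures.
From mathcomp Require Import all_boot all_order all_algebra.
From mathcomp Require Import boolp reals sequences exp.
From mathcomp Require Import ring lra.

(* View f as the Cayley graph x ~ y iff f (x - y) = 1, which is regular; let rho
   be its density.  By Fourier analysis the monochromatic pairs of any
   2-coloring of this graph number at least as many as those of the best linear
   coloring x |-> dot a x, because they are an average of the latter with the
   squared Fourier coefficients of the coloring as weights; so if f is eps-far
   from OCF, then the graph is eps-far from bipartite.  Since an odd dependency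
   in F_2^n is exactly what obstructs solving dot a x = 1, an accepting seed is
   a 2-colorable sample.

   Split the sample into U, of size about log(1/eps)/rho, and a remainder.  With
   good probability all but eps/4 of the vertices have a neighbor in U, and then
   each of the 2^|U| colorings of U forces a coloring of these vertices, with a
   conflict graph of density at least eps/2.  Since conflict degrees are at most
   those of the Cayley graph, conflicts are not concentrated on few vertices,
   and s further samples avoid them all with probability at most
   exp((1 - s eps / 4) / rho); for s = O(log(1/eps)/eps) this beats the union
   bound over the colorings of U.  Regularity is what makes this work with
   O~(1/eps) vertices. *)

Set Implicit Arguments.
Unset Strict Implicit.
Unset Printing Implicit Defensive.

Import Order.TTheory GRing.Theory Num.Theory.
Local Open Scope ring_scope.

Lemma card_sum_mem (T : finType) (A : {pred T}) : #|A| = (\sum_x (x \in A))%N.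
Proof. by rewrite -sum1_card big_mkcond; apply: eq_bigr => x _; case: ifP. Qed.

Lemma natr_card_sum_mem (R : pzSemiRingType) (T : finType) (A : {pred T}) :
  #|A|%:R = \sum_x (x \in A)%:R :> R.
Proof. by rewrite card_sum_mem natr_sum. Qed.

Lemma submx_of_kernel (F : fieldType) m p n (A : 'M[F]_(m, n)) (B : 'M_(p, n)) :
  (forall v : 'cV_n, B *m v = 0 -> A *m v = 0) -> (A <= B)%MS.
Proof.
move=> kerBA; rewrite submxE; apply/eqP/matrixP => i j.
have /colP/(_ i) : A *m col j (cokermx B) = 0.
  by rewrite kerBA // colE mulmxA mulmx_coker mul0mx.
by rewrite colE mulmxA -colE !mxE.
Qed.

Section F2.

Lemma F2_eq0_or_eq1 (z : 'F_2) : z = 0 \/ z = 1.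
Proof. by case: z => [[|[|//]] i]; [left | right]; apply: val_inj. Qed.

Lemma F2_natr m : m%:R = (odd m)%:R :> 'F_2.
Proof. by rewrite -(Fp_nat_mod (isT : prime 2)) modn2. Qed.

Lemma F2_natr_neq0 (z : 'F_2) : z = (z != 0)%:R.
Proof. by case: (F2_eq0_or_eq1 z) => ->. Qed.

Variable M : lmodType 'F_2.

Lemma F2_addrr (x : M) : x + x = 0.
Proof. by rewrite -mulr2n -scaler_nat F2_natr scale0r. Qed.

Lemma F2_oppr (x : M) : - x = x.
Proof. by apply/esym/eqP; rewrite -addr_eq0 F2_addrr. Qed.

End F2.

Lemma card_F2vec_gt0 n : (0 < #|{: F2vec n}|)%N.
Proof. by apply/card_gt0P; exists 0. Qed.

Section DotProduct.
Variable n : nat.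
Implicit Types (a x y : F2vec n) (f : boolfun n) (A : {set F2vec n}).

Definition dot a x : 'F_2 := (x *m a^T) 0 0.

Lemma dotC a x : dot a x = dot x a.
Proof. by rewrite /dot -[a *m _]trmxK trmx_mul trmxK [RHS]mxE. Qed.

Lemma dotD a x y : dot a (x + y) = dot a x + dot a y.
Proof. by rewrite /dot mulmxDl mxE. Qed.

Lemma dot0 a : dot a 0 = 0.
Proof. by rewrite /dot mul0mx mxE. Qed.

Lemma dot_nondegenerate x : x != 0 -> exists a, dot a x = 1.
Proof.
move=> /rV0Pn[j xj_neq0]; exists (delta_mx 0 j).
by rewrite /dot trmx_delta -colE mxE [LHS]F2_natr_neq0 xj_neq0.
Qed.

Lemma F2_system_solvable m (x : 'I_m -> F2vec n) :
  (forall S : {set 'I_m}, \sum_(i in S) x i = 0 -> ~~ odd #|S|) ->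
  exists a, forall i, dot a (x i) = 1.
Proof.
move=> even_dep; pose X := \matrix_(i < m) x i.
have /submxP[a Xa] : ((const_mx 1 : 'rV['F_2]_m) <= X^T)%MS.
  apply: submx_of_kernel => v Xv0; pose S := [set i | v i 0 != 0].
  have vS i : v i 0 = (i \in S)%:R by rewrite inE -F2_natr_neq0.
  have {even_dep} evenS : ~~ odd #|S|.
    apply: even_dep; apply/rowP => l.
    transitivity ((X^T *m v) l 0); last by rewrite Xv0 !mxE.
    rewrite summxE mxE [LHS]big_mkcond; apply: eq_bigr => i _.
    by rewrite !mxE vS; case: ifP; rewrite ?mulr1 ?mulr0.
  apply/rowP => j; rewrite ord1 !mxE.
  under eq_bigr do rewrite mxE mul1r vS.
  by rewrite -natr_card_sum_mem F2_natr (negbTE evenS).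
exists a => i; have := congr1 (fun M : 'rV_m => M 0 i) Xa.
rewrite dotC /dot mxE => ->; rewrite !mxE; apply: eq_bigr => j _.
by rewrite !mxE.
Qed.

Lemma ocf_onP A f :
  ocf_on A f <-> exists a, {in A, forall x, f x -> dot a x = 1}.
Proof.
split=> [ocfA | [a a_sol] m x odd_m [xA fx sum0]].
  pose B := [set x in A | f x].
  have [|a a_sol] := @F2_system_solvable #|B| (fun i => enum_val i).
    move=> S sum0; apply/negP => odd_S.
    apply: (ocfA #|S| (fun i => enum_val (enum_val i)) odd_S).
    have enumB (i : 'I_#|S|) : enum_val (enum_val i) \in B := enum_valP _.
    split=> [i|i|]; last by rewrite -(big_enum_val (fun i => enum_val i)).
      by have := enumB i; rewrite inE => /andP[].
    by have := enumB i; rewrite inE => /andP[].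
  exists a => x xA fx; have xB : x \in B by rewrite inE xA.
  by rewrite -(enum_rankK_in xB xB).
have : dot a (\sum_i x i) = m%:R.
  rewrite -[in RHS](card_ord m) -sumr_const (big_morph _ (dotD a) (dot0 a)).
  by apply: eq_bigr => i _; apply/a_sol.
by rewrite sum0 dot0 F2_natr odd_m.
Qed.

Definition falsified f a : {set F2vec n} := [set x | f x && (dot a x == 0)].

Lemma eps_far_card_falsified (R : realType) (eps : R) f a :
  eps_far eps f -> eps * #|{: F2vec n}|%:R <= #|falsified f a|%:R.
Proof.
move=> far; pose g : boolfun n := [ffun x => f x && (dot a x != 0)].
have ocf_g : OCF g.
  apply/ocf_onP; exists a => x _; rewrite ffunE => /andP[_].
  by case: (F2_eq0_or_eq1 (dot a x)) => ->; rewrite ?eqxx.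
rewrite -ler_pdivlMr ?ltr0n ?card_F2vec_gt0 //; apply: (le_trans far).
suff -> : #|falsified f a|%:R / #|{: F2vec n}|%:R = fdist R f g.
  by apply: bigmin_le_cond; apply/asboolP.
congr (_%:R / _); apply: eq_card => x; rewrite !inE ffunE.
by case: (f x); case: eqP.
Qed.

End DotProduct.

Section Graphs.
Variable V : finType.
Implicit Types (e : rel V) (W : {set V}) (c : V -> bool) (d : nat).
Implicit Types (v : V) (l : seq V).

Definition num_arcs e : nat := (\sum_v #|e v|)%N.

Definition neighbors e v : {set V} := [set w | e v w].

Definition delete_vertices W e : rel V :=
  fun v w => [&& e v w, v \notin W & w \notin W].

Definition monochromatic e c : rel V := fun v w => e v w && (c v == c w).

Definition independent e l : bool := pairwise [rel v w | ~~ e v w] l.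

Definition two_colorable e l : bool :=
  `[< exists c, independent (monochromatic e c) l >].

Definition far_from_bipartite (R : numDomainType) (eps : R) e : Prop :=
  forall c, eps * #|V|%:R ^+ 2 <= (num_arcs (monochromatic e c))%:R.

Lemma card_delete_vertices W e v : (#|delete_vertices W e v| <= #|e v|)%N.
Proof.
by apply/subset_leq_card/subsetP => w; rewrite !unfold_in => /and3P[].
Qed.

Lemma card_monochromatic e c v : (#|monochromatic e c v| <= #|e v|)%N.
Proof.
by apply/subset_leq_card/subsetP => w; rewrite !unfold_in => /andP[].
Qed.

Lemma num_arcs_le_max_degree e d :
  (forall v, #|e v| <= d)%N -> (num_arcs e <= d * #|V|)%N.
Proof.
move=> deg_e; rewrite mulnC -sum_nat_const.
by apply: leq_sum => v _; apply: deg_e.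
Qed.

Lemma num_arcs_le_delete_vertices e d W :
  symmetric e -> (forall v, #|e v| <= d)%N ->
  (num_arcs e <= num_arcs (delete_vertices W e) + 2 * d * #|W|)%N.
Proof.
move=> sym_e deg_e.
have arcs_from_W : (\sum_v \sum_w (v \in W) * e v w <= d * #|W|)%N.
  rewrite mulnC card_sum_mem big_distrl /=; apply: leq_sum => v _.
  by rewrite -big_distrr leq_mul // (leq_trans _ (deg_e v)) // card_sum_mem.
rewrite -mulnA mul2n -addnn.
apply: leq_trans (leq_add (leqnn _) (leq_add arcs_from_W arcs_from_W)).
rewrite [X in (_ <= _ + (X + _))%N]exchange_big /= -!big_split /=.
apply: leq_sum => v _; rewrite !card_sum_mem -!big_split /=.
apply: leq_sum => w _; rewrite 2![w \in _]unfold_in /delete_vertices sym_e.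
by case: (e w v); case: (v \in W); case: (w \in W).
Qed.

Lemma delete_vertices_sym W e : symmetric e -> symmetric (delete_vertices W e).
Proof.
move=> sym_e v w; rewrite /delete_vertices sym_e; congr (_ && _).
exact: andbC.
Qed.

Lemma monochromatic_sym e c : symmetric e -> symmetric (monochromatic e c).
Proof. by move=> sym_e v w; rewrite /monochromatic sym_e eq_sym. Qed.

End Graphs.

Section Fourier.
Variables (R : realFieldType) (n : nat).
Implicit Types (a x y : F2vec n) (g : F2vec n -> R).
Local Notation N := (#|{: F2vec n}|%:R : R).

Definition chi a x : R := (-1) ^+ (dot a x != 0).

Lemma chiC a x : chi a x = chi x a.
Proof. by rewrite /chi dotC. Qed.

Lemma chiD a x y : chi a (x + y) = chi a x * chi a y.
Proof.
rewrite /chi -signr_addb dotD.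
by case: (F2_eq0_or_eq1 (dot a x)) => ->; case: (F2_eq0_or_eq1 (dot a y)) => ->.
Qed.

Lemma chi0 a : chi a 0 = 1.
Proof. by rewrite /chi dot0 eqxx. Qed.

Lemma dot_eq0_chi a x : (dot a x == 0)%:R = (1 + chi a x) / 2.
Proof. by rewrite /chi; case: eqP => _ /=; rewrite ?expr0 ?expr1; field. Qed.

Lemma sum_chi x : \sum_a chi a x = (x == 0)%:R * N.
Proof.
have [->|/dot_nondegenerate[b xb]] := eqVneq x 0.
  by rewrite mul1r -sumr_const; apply: eq_bigr => a _; rewrite chi0.
suff : \sum_a chi a x = - \sum_a chi a x by rewrite mul0r; lra.
rewrite {1}(reindex_inj (addrI b)) -sumrN; apply: eq_bigr => a _.
by rewrite chiC chiD -!(chiC _ x) {1}/chi xb /= mulN1r.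
Qed.

Definition fourier g a : R := \sum_y g y * chi a y.

Lemma fourier_autocorrelation g x :
  \sum_a chi a x * fourier g a ^+ 2 = N * \sum_y g y * g (y + x).
Proof.
transitivity (\sum_y \sum_z g y * g z * \sum_a chi a (x + y + z)).
  under [in RHS]eq_bigr do under eq_bigr do rewrite mulr_sumr.
  under [in RHS]eq_bigr do rewrite exchange_big.
  rewrite /= [in RHS]exchange_big; apply: eq_bigr => a _ /=.
  rewrite expr2 mulr_suml mulr_sumr; apply: eq_bigr => y _.
  rewrite !mulr_sumr; apply: eq_bigr => z _.
  by rewrite !chiD; ring.
rewrite mulr_sumr; apply: eq_bigr => y _.
under eq_bigr do rewrite sum_chi.
rewrite (bigD1 (y + x)) //= big1 => [|z zyx].
  by rewrite (addrC y) F2_addrr eqxx /= mul1r; ring.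
by rewrite addr_eq0 F2_oppr eq_sym addrC (negbTE zyx) mul0r mulr0.
Qed.

Lemma parseval g : \sum_a fourier g a ^+ 2 = N * \sum_y g y ^+ 2.
Proof.
have := fourier_autocorrelation g 0.
under eq_bigr do rewrite chi0 mul1r.
by move=> ->; congr (_ * _); apply: eq_bigr => y _; rewrite addr0.
Qed.

End Fourier.

Section Cayley.
Variable n : nat.
Implicit Types (f : boolfun n) (c : F2vec n -> bool).

Definition cayley f : rel (F2vec n) := fun x y => f (x - y).

Lemma cayley_sym f : symmetric (cayley f).
Proof. by move=> x y; rewrite /cayley -[x - y]F2_oppr opprB. Qed.

Lemma cayley_regular f x : #|cayley f x| = #|[pred y | f y]|.
Proof.
rewrite !card_sum_mem (reindex_inj (subrI x)); apply: eq_bigr => y _.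
by rewrite unfold_in inE /cayley subKr.
Qed.

Lemma num_arcs_monochromatic_cayley f c :
  num_arcs (monochromatic (cayley f) c) =
  (\sum_x f x * #|[pred y | c y == c (y + x)%R]|)%N.
Proof.
under [RHS]eq_bigr do rewrite card_sum_mem big_distrr /=.
rewrite exchange_big; apply: eq_bigr => y _ /=.
rewrite card_sum_mem (reindex_inj (addrI y)); apply: eq_bigr => x _ /=.
by rewrite unfold_in /monochromatic /cayley opprD addNKr F2_oppr mulnb.
Qed.

Variable R : realFieldType.
Local Notation N := (#|{: F2vec n}|%:R : R).

Definition color_sign c y : R := (-1) ^+ c y.

Lemma fourier_monochromatic_cayley f c :
  \sum_a fourier (color_sign c) a ^+ 2 * #|falsified f a|%:R =
  N * (num_arcs (monochromatic (cayley f) c))%:R.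
Proof.
set g := color_sign c; rewrite num_arcs_monochromatic_cayley.
under [LHS]eq_bigr do rewrite natr_card_sum_mem mulr_sumr.
rewrite exchange_big natr_sum mulr_sumr; apply: eq_bigr => x _ /=.
transitivity ((f x)%:R / 2 *
    (\sum_a fourier g a ^+ 2 + \sum_a chi R a x * fourier g a ^+ 2)).
  rewrite -big_split mulr_sumr; apply: eq_bigr => a _ /=.
  by rewrite inE -mulnb natrM dot_eq0_chi; field.
rewrite parseval fourier_autocorrelation natrM.
rewrite -mulrDr mulrCA -mulrA -big_split; congr (_ * (_ * _)).
rewrite /= natr_card_sum_mem mulr_sumr; apply: eq_bigr => y _ /=.
rewrite inE /g /color_sign.
by case: (c y); case: (c _); rewrite /= ?expr0 ?expr1; field.
Qed.

Lemma cayley_far_from_bipartite (eps : R) f :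
  (forall a, eps * N <= #|falsified f a|%:R) ->
  far_from_bipartite eps (cayley f).
Proof.
move=> far c; pose g := color_sign c.
have N_gt0 : 0 < N by rewrite ltr0n card_F2vec_gt0.
have norm_g : \sum_a fourier g a ^+ 2 = N ^+ 2.
  rewrite parseval expr2 -[in X in _ = _ * X]sumr_const; congr (_ * _).
  by apply: eq_bigr => y _; rewrite /g /color_sign sqrr_sign.
rewrite -(ler_pM2l N_gt0) -fourier_monochromatic_cayley.
apply: le_trans (_ : \sum_a fourier g a ^+ 2 * (eps * N) <= _).
  by rewrite -mulr_suml norm_g; lra.
by apply: ler_sum => a _; rewrite ler_wpM2l ?sqr_ge0.
Qed.

End Cayley.

Section Average.
Variables (R : realFieldType) (V : finType).
Local Notation N := (#|V|%:R : R).
Implicit Types (k m : nat) (F G : seq V -> R) (P : pred V).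

Fixpoint avg k F : R :=
  if k is k'.+1 then N^-1 * \sum_v avg k' (fun l => F (v :: l)) else F [::].

Lemma ler_avg k F G :
  (forall l, size l = k -> F l <= G l) -> avg k F <= avg k G.
Proof.
elim: k F G => [|k IHk] F G leFG /=; first exact: leFG.
rewrite ler_wpM2l ?invr_ge0 ?ler0n //; apply: ler_sum => v _.
by apply: IHk => l size_l; apply: leFG; rewrite /= size_l.
Qed.

Lemma eq_avg k F G : F =1 G -> avg k F = avg k G.
Proof. by move=> /funext ->. Qed.

Lemma avg_sum (I : finType) k (F : I -> seq V -> R) :
  avg k (fun l => \sum_i F i l) = \sum_i avg k (F i).
Proof.
elim: k F => //= k IHk F; rewrite -mulr_sumr exchange_big; congr (_ * _).
by apply: eq_bigr => v _; rewrite IHk.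
Qed.

Lemma avgD k F G : avg k (fun l => F l + G l) = avg k F + avg k G.
Proof.
elim: k F G => //= k IHk F G; rewrite -mulrDr -big_split.
by under eq_bigr do rewrite IHk.
Qed.

Lemma avgMl k (c : R) F : avg k (fun l => c * F l) = c * avg k F.
Proof.
elim: k F => //= k IHk F.
by under eq_bigr do rewrite IHk; rewrite -mulr_sumr mulrCA.
Qed.

Lemma avg_cat k m F :
  avg (k + m) F = avg k (fun l => avg m (fun l' => F (l ++ l'))).
Proof. by elim: k F => //= k IHk F; under eq_bigr do rewrite IHk. Qed.

Lemma avg_all k P : avg k (fun l => (all P l)%:R) = (#|P|%:R / N) ^+ k.
Proof.
elim: k => [|k IHk] /=; first by rewrite expr0.
under eq_bigr => v _.
  under eq_avg do rewrite -mulnb natrM.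
  by rewrite avgMl IHk; over.
by rewrite -mulr_suml -natr_card_sum_mem exprS mulrCA mulrA.
Qed.

Lemma avg_ffun k F :
  avg k F = (\sum_(alpha : {ffun 'I_k -> V}) F (codom alpha)) / N ^+ k.
Proof.
elim: k F => [|k IHk] F /=.
  rewrite expr0 divr1 (eq_bigl (pred1 [ffun i : 'I_0 => ffun0 (card_ord 0) i])).
    rewrite big_pred1_eq /codom /image_mem (_ : enum _ = [::]) //.
    by apply/nilP; rewrite /nilp -cardE card_ord.
  by move=> alpha; apply/esym/eqP/ffunP; case.
under eq_bigr do rewrite IHk.
rewrite -mulr_suml exprS invfM mulrCA; congr (_ * _); rewrite pair_big /=.
pose cons_ffun (p : V * {ffun 'I_k -> V}) : {ffun 'I_k.+1 -> V} :=
  [ffun i => if unlift ord0 i is Some j then p.2 j else p.1].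
pose uncons_ffun (alpha : {ffun 'I_k.+1 -> V}) : V * {ffun 'I_k -> V} :=
  (alpha ord0, [ffun j => alpha (lift ord0 j)]).
rewrite [RHS](reindex cons_ffun) /=; last first.
  exists uncons_ffun => [[v alpha] _|alpha _].
    congr (_, _); first by rewrite ffunE unlift_none.
    by apply/ffunP => j; rewrite !ffunE liftK.
  apply/ffunP => i; rewrite ffunE.
  by case: unliftP => [j|] ->; rewrite ?ffunE.
apply: eq_bigr => [[v alpha] _]; congr (F _).
rewrite /codom /image_mem enum_ordSl /= ffunE unlift_none -map_comp.
by congr (_ :: _); apply: eq_map => j; rewrite /= ffunE liftK.
Qed.

Hypothesis V_gt0 : (0 < #|V|)%N.

Lemma avg_const k (c : R) : avg k (fun=> c) = c.
Proof.
elim: k => //= k ->; rewrite sumr_const -[c *+ _]mulr_natl mulrA.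
by rewrite mulVf ?mul1r // pnatr_eq0 -lt0n.
Qed.

Lemma avg_markov k F G (a b : R) : 0 < a -> 0 <= b ->
  (forall l, 0 <= G l) -> (forall l, F l <= 1) ->
  (forall l, size l = k -> G l <= a -> F l <= b) ->
  avg k F <= a^-1 * avg k G + b.
Proof.
move=> a_gt0 b_ge0 G_ge0 F_le1 F_le_b.
rewrite -(avg_const k b) -avgMl -avgD; apply: ler_avg => l size_l.
have [/(F_le_b _ size_l) Fb | a_lt_G] := leP (G l) a.
  by apply: (le_trans Fb); rewrite lerDr mulr_ge0 // invr_ge0 ltW.
by rewrite (le_trans (F_le1 l)) // ler_wpDr // mulrC ler_pdivlMr ?mul1r // ltW.
Qed.

Lemma avg_union_bound (I : finType) k (B : pred (seq V))
    (E : I -> pred (seq V)) :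
  (forall l, B l -> exists i, E i l) ->
  avg k (fun l => (B l)%:R) <= \sum_i avg k (fun l => (E i l)%:R).
Proof.
move=> B_covered; rewrite -avg_sum; apply: ler_avg => l _.
case: (boolP (B l)) => [/B_covered[i Eil]|_]; last first.
  by apply: sumr_ge0 => i _; rewrite ler0n.
by rewrite (bigD1 i) //= Eil lerDl; apply: sumr_ge0 => j _; rewrite ler0n.
Qed.

End Average.

Section UniformProbability.
Variables (R : realType) (T : finType).
Implicit Types E : pred T.

Lemma le_Pr E1 E2 : subpred E1 E2 -> Pr R E1 <= Pr R E2.
Proof.
move=> sub; rewrite ler_wpM2r ?invr_ge0 ?ler0n // ler_nat.
by apply/subset_leq_card/subsetP => x; apply: sub.
Qed.

Lemma Pr_predC E : (0 < #|T|)%N -> Pr R [predC E] = 1 - Pr R E.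
Proof.
move=> T_gt0; rewrite /Pr; apply/eqP; rewrite eq_sym subr_eq -mulrDl -natrD.
by rewrite addnC cardC divff // pnatr_eq0 -lt0n.
Qed.

Lemma Pr_predT E : (0 < #|T|)%N -> E =1 xpredT -> Pr R E = 1.
Proof.
move=> T_gt0 ET; rewrite /Pr (_ : #|E| = #|T|) ?divff ?pnatr_eq0 -?lt0n //.
by apply: eq_card => x; apply: ET.
Qed.

Lemma Pr_codom k (B : pred (seq T)) :
  Pr R [pred alpha : {ffun 'I_k -> T} | B (codom alpha)] =
  avg k (fun l => (B l)%:R).
Proof.
by rewrite avg_ffun /Pr card_ffun card_ord natrX natr_card_sum_mem.
Qed.

End UniformProbability.

Section Exponential.
Variable R : realType.
Implicit Types x : R.

Lemma expRN_le1Bhalf x : 0 <= x <= 1 -> expR (- x) <= 1 - x / 2.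
Proof.
move=> /andP[x_ge0 x_le1]; rewrite expRN -div1r ler_pdivrMr ?expR_gt0 //.
apply: (@le_trans _ _ ((1 - x / 2) * (1 + x))); first by nra.
by apply: ler_wpM2l; [lra | apply: expR_ge1Dx].
Qed.

Lemma expr1B_le_expR x m : x <= 1 -> (1 - x) ^+ m <= expR (- (m%:R * x)).
Proof.
move=> x_le1; rewrite -mulrN expRM_natl lerXn2r ?nnegrE ?expR_ge0 //.
  by rewrite subr_ge0.
exact: expR_ge1Dx.
Qed.

End Exponential.

Section IndependentSequences.
Variables (R : realType) (V : finType) (e : rel V) (d : nat).
Hypothesis V_gt0 : (0 < #|V|)%N.
Hypothesis sym_e : symmetric e.
Hypothesis d_gt0 : (0 < d)%N.
Hypothesis deg_e : forall v, (#|e v| <= d)%N.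
Implicit Types (v : V) (W : {set V}) (l : seq V).
Local Notation N := (#|V|%:R : R).

Let N_gt0 : 0 < N. Proof. by rewrite ltr0n. Qed.
Let dR_gt0 : 0 < d%:R :> R. Proof. by rewrite ltr0n. Qed.

Definition avoids W l : bool := all [predC W] l.

Lemma avoids_independent_cons W v l :
  avoids W (v :: l) && independent e (v :: l) =
  (v \notin W) && (avoids (W :|: neighbors e v) l && independent e l).
Proof.
rewrite /avoids /= -andbA; congr (_ && _); rewrite andbA; congr (_ && _).
by rewrite -all_predI; apply: eq_all => w; rewrite /= !inE negb_or.
Qed.

Definition potential W : R := expR ((N - #|W|%:R) / d%:R).

Definition degree_ratio : R := (num_arcs e)%:R / (d%:R * N).

Lemma degree_ratio_le1 : degree_ratio <= 1.
Proof.
have := num_arcs_le_max_degree deg_e; rewrite -(ler_nat R) natrM => arcs_le.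
by rewrite /degree_ratio ler_pdivrMr ?mul1r ?mulr_gt0.
Qed.

Lemma potential_setU_neighbors W v : v \notin W ->
  potential (W :|: neighbors e v) <=
  potential W * (1 - #|delete_vertices W e v|%:R / (2 * d%:R)).
Proof.
move=> vW; set j := #|_|.
have j_le_d : (j <= d)%N.
  by apply: leq_trans (deg_e v); apply: card_delete_vertices.
rewrite /potential.
have -> : #|W :|: neighbors e v|%:R = #|W|%:R + j%:R :> R.
  rewrite -natrD -(cardsID W) setDUl setDv set0U (setIidPr (subsetUl _ _)).
  congr (_ + _)%:R; apply: eq_card => w.
  by rewrite !inE unfold_in /delete_vertices vW andbC.
rewrite opprD addrA mulrBl expRD ler_wpM2l ?expR_ge0 //.
rewrite [2 * _]mulrC invfM mulrA; apply: expRN_le1Bhalf.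
by rewrite divr_ge0 ?ler0n //= ler_pdivrMr // mul1r ler_nat.
Qed.

(* The next vertex either falls in [W] or enlarges [W], and the two effects add
   up to the same factor whatever [#|W|] is. *)
Lemma mean_potential_step W :
  N^-1 * (\sum_v (v \notin W)%:R * potential (W :|: neighbors e v)) <=
  (1 - degree_ratio / 2) * potential W.
Proof.
pose j v : R := #|delete_vertices W e v|%:R / (2 * d%:R).
apply: (@le_trans _ _ (N^-1 * (\sum_v ((v \notin W)%:R - j v)) * potential W)).
  rewrite -mulrA ler_wpM2l ?invr_ge0 ?ler0n // mulr_suml; apply: ler_sum => v _.
  have [vW|vW] := boolP (v \in W).
    rewrite mul0r sub0r {}/j (_ : #|_| = 0%N) ?mul0r ?oppr0 ?mul0r //.
    by apply: eq_card0 => w; rewrite unfold_in /delete_vertices vW andbF.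
  by rewrite mul1r [leRHS]mulrC potential_setU_neighbors.
apply: ler_wpM2r; first exact: expR_ge0.
have := num_arcs_le_delete_vertices W sym_e deg_e.
rewrite -(ler_nat R) natrD !natrM => arcs_le.
have -> : \sum_v ((v \notin W)%:R - j v) =
    N - #|W|%:R - (num_arcs (delete_vertices W e))%:R / (2 * d%:R).
  rewrite sumrB -mulr_suml -!natr_sum; congr (_ - _).
  rewrite -(cardsC W) natrD addrAC subrr add0r card_sum_mem.
  by under [in RHS]eq_bigr do rewrite inE.
have -> : 1 - degree_ratio / 2 = N^-1 * (N - (num_arcs e)%:R / (2 * d%:R)).
  by rewrite /degree_ratio; field; rewrite !gt_eqF.
rewrite ler_wpM2l ?invr_ge0 ?ler0n // -addrA lerD2l -opprD lerN2.
rewrite ler_pdivrMr ?mulr_gt0 // mulrDl divfK ?gt_eqF ?mulr_gt0 //.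
by rewrite addrC [#|W|%:R * _]mulrC.
Qed.

Lemma avg_avoiding_independent s W :
  avg s (fun l => (avoids W l && independent e l)%:R) <=
  potential W * (1 - degree_ratio / 2) ^+ s.
Proof.
have factor_ge0 : 0 <= 1 - degree_ratio / 2 by have := degree_ratio_le1; lra.
elim: s W => [|s IHs] W.
  rewrite expr0 mulr1 -[leLHS]expR0 ler_expR divr_ge0 ?ler0n //.
  by rewrite subr_ge0 ler_nat max_card.
rewrite [avg _ _]/=; under eq_bigr => v _.
  under eq_avg do rewrite avoids_independent_cons -mulnb natrM.
  by rewrite avgMl; over.
rewrite exprS mulrA [potential W * _]mulrC.
apply: le_trans (ler_wpM2r (exprn_ge0 s factor_ge0) (mean_potential_step W)).
rewrite -mulrA ler_wpM2l ?invr_ge0 ?ler0n // mulr_suml; apply: ler_sum => v _.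
by rewrite -mulrA ler_wpM2l ?ler0n.
Qed.

Lemma avg_independent s :
  avg s (fun l => (independent e l)%:R) <=
  expR (N / d%:R) * (1 - degree_ratio / 2) ^+ s.
Proof.
have <- : potential set0 = expR (N / d%:R) by rewrite /potential cards0 subr0.
apply: le_trans (avg_avoiding_independent s set0); apply: ler_avg => l _.
have -> // : avoids set0 l by apply/allP => v _; rewrite /= inE.
Qed.

End IndependentSequences.

Section TwoColorableSample.
Variables (R : realType) (V : finType) (e : rel V) (d : nat) (eps : R).
Hypothesis V_gt0 : (0 < #|V|)%N.
Hypothesis sym_e : symmetric e.
Hypothesis regular_e : forall v, #|e v| = d.
Hypothesis eps_gt0 : 0 < eps.
Hypothesis far_e : far_from_bipartite eps e.
Implicit Types (U l : seq V) (b : seq bool).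
Local Notation N := (#|V|%:R : R).
Local Notation density := (d%:R / N).

Let N_gt0 : 0 < N. Proof. by rewrite ltr0n. Qed.

Lemma density_le1 : density <= 1.
Proof.
rewrite ler_pdivrMr // mul1r ler_nat.
by have /card_gt0P[v _] := V_gt0; rewrite -(regular_e v) max_card.
Qed.

Lemma card_monochromatic_le_degree c v : (#|monochromatic e c v| <= d)%N.
Proof. by rewrite -(regular_e v) card_monochromatic. Qed.

Lemma far_from_bipartite_le_density : eps <= density.
Proof.
rewrite ler_pdivlMr // -(ler_pM2r N_gt0) -mulrA -expr2.
apply: (le_trans (far_e xpredT)).
rewrite -natrM ler_nat; apply: num_arcs_le_max_degree => v.
exact: card_monochromatic_le_degree.
Qed.

Let density_gt0 : 0 < density.
Proof. exact: lt_le_trans eps_gt0 far_from_bipartite_le_density. Qed.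

Let dR_gt0 : 0 < d%:R :> R.
Proof. by rewrite -(divfK (lt0r_neq0 N_gt0) d%:R) mulr_gt0. Qed.

Let eps_div_density_le1 : eps / density <= 1.
Proof. by rewrite ler_pdivrMr // mul1r far_from_bipartite_le_density. Qed.

Definition uncovered U : {set V} := [set v | ~~ has (e v) U].

Lemma avg_uncovered t :
  avg t (fun U => #|uncovered U|%:R) = N * (1 - density) ^+ t.
Proof.
under eq_avg do rewrite natr_card_sum_mem.
rewrite avg_sum; transitivity (\sum_(v : V) (1 - density) ^+ t); last first.
  by rewrite sumr_const -[LHS]mulr_natl.
apply: eq_bigr => v _; under eq_avg do rewrite inE -all_predC.
have card_non_neighbors : #|[predC e v]|%:R = N - d%:R.
  by rewrite -(regular_e v) -(cardC (e v)) natrD addrAC subrr add0r.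
by rewrite avg_all card_non_neighbors mulrBl divff ?gt_eqF.
Qed.

(* [b] lists the colors of [U]; an uncovered vertex gets a junk color. *)
Definition forced U b v : bool := ~~ nth false b (find (e v) U).

Definition conflict U b : rel V :=
  delete_vertices (uncovered U) (monochromatic e (forced U b)).

Lemma conflict_sym U b : symmetric (conflict U b).
Proof. exact/delete_vertices_sym/monochromatic_sym. Qed.

Lemma card_conflict U b v : (#|conflict U b v| <= d)%N.
Proof.
apply: leq_trans (card_delete_vertices _ _ _) _.
exact: card_monochromatic_le_degree.
Qed.

Lemma degree_ratio_conflict_ge U b : #|uncovered U|%:R <= eps * N / 4 ->
  eps / density <= 2 * degree_ratio R (conflict U b) d.
Proof.
move=> few_uncovered.
have := num_arcs_le_delete_vertices (uncovered U)
  (monochromatic_sym (forced U b) sym_e) (card_monochromatic_le_degree _).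
rewrite -(ler_nat R) natrD !natrM => /(le_trans (far_e _)) arcs_ge.
have -> : eps / density = eps * N / d%:R by field; rewrite !gt_eqF.
rewrite /degree_ratio mulrA ler_pdivlMr ?mulr_gt0 //.
have -> : eps * N / d%:R * (d%:R * N) = eps * N ^+ 2 by field; rewrite gt_eqF.
have : 2 * d%:R * #|uncovered U|%:R <= 2 * N * (eps * N / 4).
  rewrite ler_pM ?mulr_ge0 ?ler0n // ler_pM2l //.
  by rewrite -[N]mul1r -ler_pdivrMr // density_le1.
by rewrite -/(conflict U b); lra.
Qed.

Lemma two_colorable_cat U l : two_colorable e (U ++ l) ->
  exists b : (size U).-tuple bool, independent (conflict U b) l.
Proof.
move=> /asboolP[c]; rewrite /independent pairwise_cat.
move=> /and3P[/allrelP indep_Ul _ indep_l].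
have forcedE v : v \in l -> v \notin uncovered U -> forced U (map c U) v = c v.
  rewrite inE negbK => vl cov_v.
  have lt_find : (find (e v) U < size U)%N by rewrite -has_find.
  rewrite /forced (nth_map v) //.
  have := indep_Ul _ _ (mem_nth v lt_find) vl.
  rewrite /= /monochromatic sym_e (nth_find v cov_v) /=.
  by case: (c v); case: (c _).
exists (map_tuple c (in_tuple U)).
apply: (sub_in_pairwise (P := [in l])) indep_l => [v w vl wl|]; last exact/allP.
apply: contra => /and3P[/andP[e_vw eq_forced] cov_v cov_w].
by rewrite /monochromatic e_vw -!forcedE.
Qed.

Lemma avg_two_colorable_covered U s : #|uncovered U|%:R <= eps * N / 4 ->
  avg s (fun l => (two_colorable e (U ++ l))%:R) <=
  2 ^+ size U * (expR density^-1 * (1 - eps / density / 4) ^+ s).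
Proof.
move=> few_uncovered.
apply: le_trans (avg_union_bound R s (@two_colorable_cat U)) _.
have -> : 2 ^+ size U = #|{: (size U).-tuple bool}|%:R :> R.
  by rewrite card_tuple card_bool natrX.
rewrite mulr_natl -sumr_const; apply: ler_sum => b _.
have d_gt0 : (0 < d)%N by rewrite -(ltr0n R).
apply: le_trans (avg_independent R V_gt0 (conflict_sym U b) d_gt0 _ s) _.
  exact: card_conflict.
rewrite invf_div ler_wpM2l ?expR_ge0 //; apply: lerXn2r; rewrite ?nnegrE.
- by have := degree_ratio_le1 R V_gt0 d_gt0 (card_conflict U b); lra.
- by have := eps_div_density_le1; lra.
- by have := degree_ratio_conflict_ge b few_uncovered; lra.
Qed.

Lemma avg_two_colorable t s :
  avg (t + s) (fun l => (two_colorable e l)%:R) <=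
  4 / eps * (1 - density) ^+ t +
  2 ^+ t * (expR density^-1 * (1 - eps / density / 4) ^+ s).
Proof.
rewrite avg_cat; set color_bound := 2 ^+ t * _.
have -> : 4 / eps * (1 - density) ^+ t =
    (eps * N / 4)^-1 * avg t (fun U => #|uncovered U|%:R).
  by rewrite avg_uncovered; field; rewrite !gt_eqF.
apply: avg_markov => // [|||U size_U].
- by rewrite divr_gt0 ?mulr_gt0.
- rewrite mulr_ge0 ?exprn_ge0 // mulr_ge0 ?expR_ge0 // exprn_ge0 //.
  by have := eps_div_density_le1; lra.
- move=> U; rewrite -[leRHS](avg_const V_gt0 s); apply: ler_avg => l _.
  by case: two_colorable.
- by rewrite /color_bound -size_U; apply: avg_two_colorable_covered.
Qed.

End TwoColorableSample.

Section SampleSize.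
Variable R : realType.
Implicit Types (eps rho x : R) (s t : nat).

(* [24 = 4 * 6] turns the covering failure [4 / eps * expR (- log_factor eps)]
   into [1 / 6]. *)
Definition log_factor eps : R := ln (24 / eps).

Definition cover_size eps rho : nat := (Num.truncn (log_factor eps / rho)).+1.

(* The edge density [rho] is unknown to the test, hence the worst case
   [rho = eps] in the first summand.  The 7 brings the exponent of the failure
   bound over all colorings of the cover down to [1 - 6 / rho <= - 5]. *)
Definition sample_size eps : nat :=
  (cover_size eps eps + (Num.truncn (4 * (log_factor eps + 7) / eps)).+1)%N.

Lemma truncnS_le x : 0 <= x -> (Num.truncn x).+1%:R <= x + 1.
Proof. by move=> x_ge0; rewrite -natr1 lerD2r truncn_le. Qed.

Lemma log_factor_ge0 eps : 0 < eps < 1 -> 0 <= log_factor eps.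
Proof.
by move=> /andP[eps_gt0 eps_lt1]; rewrite ln_ge0 // ler_pdivlMr //; lra.
Qed.

Lemma cover_failure_le eps rho t : 0 < eps -> 0 < rho <= 1 ->
  log_factor eps / rho <= t%:R -> 4 / eps * (1 - rho) ^+ t <= 1 / 6.
Proof.
move=> eps_gt0 /andP[rho_gt0 rho_le1]; rewrite ler_pdivrMr // => log_le.
apply: (@le_trans _ _ (4 / eps * expR (- log_factor eps))).
  rewrite ler_wpM2l ?divr_ge0 ?(ltW eps_gt0) //.
  by apply: le_trans (expr1B_le_expR _ rho_le1) _; rewrite ler_expR lerN2.
rewrite expRN lnK ?posrE ?divr_gt0 // le_eqVlt; apply/orP; left; apply/eqP.
by field; rewrite gt_eqF.
Qed.

Lemma color_failure_le eps rho t s : 0 < eps <= rho -> rho <= 1 ->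
  t%:R <= log_factor eps / rho + 1 -> 4 * (log_factor eps + 7) / eps <= s%:R ->
  2 ^+ t * (expR rho^-1 * (1 - eps / rho / 4) ^+ s) <= 1 / 6.
Proof.
move=> /andP[eps_gt0 eps_le_rho] rho_le1 t_le s_ge.
have rho_gt0 : 0 < rho by apply: lt_le_trans eps_le_rho.
have ratio_le1 : eps / rho / 4 <= 1.
  have : eps / rho <= 1 by rewrite ler_pdivrMr // mul1r.
  by lra.
have pow2_le : 2 ^+ t <= expR t%:R :> R.
  rewrite -[t%:R]mulr1 expRM_natl lerXn2r ?nnegrE ?expR_ge0 //.
  by have := expR_ge1Dx (1 : R); lra.
have avoid_le :
    (1 - eps / rho / 4) ^+ s <= expR (- ((log_factor eps + 7) / rho)).
  apply: le_trans (expr1B_le_expR _ ratio_le1) _; rewrite ler_expR lerN2.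
  have -> : (log_factor eps + 7) / rho =
      4 * (log_factor eps + 7) / eps * (eps / rho / 4).
    by field; rewrite !gt_eqF.
  by rewrite ler_wpM2r // !divr_ge0 // ltW.
have factor_ge0 : 0 <= (1 - eps / rho / 4) ^+ s.
  by rewrite exprn_ge0 // subr_ge0.
apply: (@le_trans _ _ (expR (- 5))); last first.
  rewrite expRN -div1r ler_wpM2l // lef_pV2 ?posrE ?expR_gt0 //.
  by have := expR_ge1Dx (5 : R); lra.
apply: le_trans (ler_pM _ _ pow2_le
  (ler_wpM2l (expR_ge0 _) avoid_le)) _; rewrite ?exprn_ge0 //.
  by rewrite mulr_ge0 ?expR_ge0.
rewrite -!expRD ler_expR.
have : 1 <= rho^-1 by rewrite invf_ge1.
by move: t_le; rewrite mulrDl; lra.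
Qed.

Lemma sample_size_split eps rho : 0 < eps <= rho -> rho <= 1 ->
  0 <= log_factor eps ->
  exists t s, sample_size eps = (t + s)%N /\
    4 / eps * (1 - rho) ^+ t +
    2 ^+ t * (expR rho^-1 * (1 - eps / rho / 4) ^+ s) <= 1 / 3.
Proof.
move=> eps_rho rho_le1 log_ge0; have /andP[eps_gt0 eps_le_rho] := eps_rho.
have rho_gt0 : 0 < rho by apply: lt_le_trans eps_le_rho.
have cover_le : (cover_size eps rho <= cover_size eps eps)%N.
  by rewrite ltnS le_truncn // ler_wpM2l // lef_pV2.
set t := cover_size eps rho in cover_le *.
exists t, (sample_size eps - t)%N; split.
  by rewrite subnKC // (leq_trans cover_le) // leq_addr.
have t_ge : log_factor eps / rho <= t%:R by apply/ltW/truncnS_gt.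
have t_le : t%:R <= log_factor eps / rho + 1.
  by rewrite truncnS_le // divr_ge0 // ltW.
have s_ge : 4 * (log_factor eps + 7) / eps <= (sample_size eps - t)%:R.
  apply: le_trans (ltW (truncnS_gt _)) _.
  rewrite ler_nat leq_subRL ?leq_add2r //.
  by rewrite (leq_trans cover_le) // leq_addr.
have rho01 : 0 < rho <= 1 by rewrite rho_gt0.
rewrite (_ : 1 / 3 = 1 / 6 + 1 / 6 :> R); last by field.
apply: lerD; first exact: cover_failure_le eps_gt0 rho01 t_ge.
exact: color_failure_le eps_rho rho_le1 t_le s_ge.
Qed.

Lemma sample_size_le eps : 0 < eps < 1 ->
  (sample_size eps)%:R <= 145 * (eps^-1 * (1 + ln eps^-1)).
Proof.
move=> eps01; have [eps_gt0 eps_lt1] := andP eps01.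
have log_ge0 := log_factor_ge0 eps01.
have inv_ge1 : 1 <= eps^-1 by rewrite invf_ge1 // ltW.
have ln_inv_ge0 : 0 <= ln eps^-1 by rewrite ln_ge0.
have log_le : log_factor eps <= 23 + ln eps^-1.
  rewrite /log_factor lnM ?posrE ?invr_gt0 // lerD2r.
  by have := @le_ln1Dx R 23; rewrite (_ : 1 + 23 = 24); [apply|]; lra.
have cover_le : (cover_size eps eps)%:R <= log_factor eps * eps^-1 + 1.
  by rewrite truncnS_le // divr_ge0 // ltW.
have rest_le : (Num.truncn (4 * (log_factor eps + 7) / eps)).+1%:R
    <= 4 * (log_factor eps + 7) * eps^-1 + 1.
  by rewrite truncnS_le // divr_ge0 ?(ltW eps_gt0) //; lra.
have : log_factor eps * eps^-1 <= (23 + ln eps^-1) * eps^-1.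
  by rewrite ler_wpM2r // invr_ge0 ltW.
have : 0 <= ln eps^-1 * eps^-1 by rewrite mulr_ge0 // invr_ge0 ltW.
by rewrite natrD; lra.
Qed.

Lemma soft_O_sample_size : soft_O sample_size (fun eps => eps^-1).
Proof. by exists 145, 1%N => eps; rewrite expr1; apply: sample_size_le. Qed.

Lemma soft_O_exp (h : R -> nat) (g : R -> R) m :
  (forall eps, 0 < eps < 1 -> 1 <= g eps) ->
  soft_O h g -> soft_O (fun eps => h eps ^ m)%N (fun eps => g eps ^+ m).
Proof.
move=> g_ge1 [C [c hC]]; exists (C ^+ m), (c * m)%N => eps eps01.
have geps_ge1 := g_ge1 _ eps01; have ln_geps_ge0 := ln_ge0 geps_ge1.
have geps_gt0 : 0 < g eps by apply: lt_le_trans geps_ge1.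
have polylog_gt0 : 0 < g eps * (1 + ln (g eps)) ^+ c.
  by rewrite mulr_gt0 ?exprn_gt0 //; lra.
have C_ge0 : 0 <= C.
  by rewrite -(pmulr_lge0 _ polylog_gt0); apply: le_trans (hC _ eps01).
have bound_ge0 := mulr_ge0 C_ge0 (ltW polylog_gt0).
rewrite natrX; apply: le_trans (lerXn2r m _ _ (hC _ eps01)) _;
  rewrite ?nnegrE ?ler0n //.
rewrite !exprMn -exprM.
do 2![rewrite ler_wpM2l ?exprn_ge0 ?(ltW geps_gt0) //].
case: m => [|m]; first by rewrite muln0.
rewrite lerXn2r ?nnegrE ?lnXn ?addr_ge0 ?mulrn_wge0 //.
by rewrite lerD2l mulrS lerDl mulrn_wge0.
Qed.

End SampleSize.

Section EdgeSamplingTest.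
Variables (R : realType) (n : nat).
Implicit Types f : boolfun n.

Lemma card_seed_gt0 k : (0 < #|{: seed k n}|)%N.
Proof. by apply/card_gt0P; exists [ffun=> 0]. Qed.

Lemma query_complexity_le k : (query_complexity k n <= k ^ 2)%N.
Proof.
apply/bigmax_leqP => alpha _; apply: leq_trans (leq_imset_card _ _) _.
by apply: leq_trans (max_card _) _; rewrite card_prod card_ord mulnn.
Qed.

Lemma edge_accepts_OCF k f (alpha : seed k n) : OCF f -> edge_accepts f alpha.
Proof.
move=> ocf_f; apply/asboolP => m x odd_m [_ fx sum0].
by apply: (ocf_f m x odd_m); split=> // i; rewrite inE.
Qed.

Lemma edge_accepts_two_colorable k f (alpha : seed k n) :
  edge_accepts f alpha -> two_colorable (cayley f) (codom alpha).
Proof.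
move=> /asboolP/ocf_onP[a a_sol]; apply/asboolP.
exists (fun x => dot a x == 0); rewrite /independent /codom /image_mem.
rewrite pairwise_map; have : pairwise ltn (map val (enum 'I_k)).
  by rewrite val_enum_ord -(sorted_pairwise ltn_trans) iota_ltn_sorted.
rewrite pairwise_map; apply: sub_pairwise => i j /= lt_ij.
apply/andP => -[f_ij]; apply/negP.
have /a_sol /(_ f_ij) : alpha i - alpha j \in edge_queries alpha.
  by apply/imsetP; exists (i, j); rewrite ?inE.
rewrite F2_oppr dotD.
by case: (F2_eq0_or_eq1 (dot a (alpha i))) => ->;
   case: (F2_eq0_or_eq1 (dot a (alpha j))) => ->.
Qed.

Lemma Pr_edge_accepts_eps_far (eps : R) f : 0 < eps < 1 -> eps_far eps f ->
  Pr R [pred alpha : seed (sample_size eps) n | edge_accepts f alpha] <= 1 / 3.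
Proof.
move=> eps01 far; have [eps_gt0 _] := andP eps01.
have V_gt0 := card_F2vec_gt0 n.
have far_cayley :=
  cayley_far_from_bipartite (fun a => eps_far_card_falsified a far).
have regular := @cayley_regular n f.
have eps_le := far_from_bipartite_le_density V_gt0 regular far_cayley.
have density_le1 := density_le1 R V_gt0 regular.
have eps_bounds : 0 < eps <= _ := introT andP (conj eps_gt0 eps_le).
have [t [s [-> failure_le]]] :=
  sample_size_split eps_bounds density_le1 (log_factor_ge0 eps01).
apply: le_trans (le_Pr _ (@edge_accepts_two_colorable _ f)) _.
rewrite Pr_codom; apply: le_trans failure_le.
exact: avg_two_colorable V_gt0 (@cayley_sym n f) regular eps_gt0 far_cayley t s.
Qed.

End EdgeSamplingTest.

Theorem theorem1p3 (R : realType) :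
  exists k q : R -> nat,
    [/\ soft_O k (fun eps => eps^-1),
        soft_O q (fun eps => eps ^- 2)
      & forall eps : R, 0 < eps < 1 -> forall n : nat,
          [/\ (query_complexity (k eps) n <= q eps)%N,
              forall f : boolfun n, OCF f ->
                Pr R [pred alpha : seed (k eps) n | edge_accepts f alpha] = 1
            & forall f : boolfun n, eps_far eps f ->
                2 / 3 <=
                Pr R [pred alpha : seed (k eps) n | ~~ edge_accepts f alpha]]].
Proof.
exists (@sample_size R), (fun eps => (sample_size eps ^ 2)%N); split.
- exact: soft_O_sample_size.
- under [X in soft_O _ X]eq_fun do rewrite -exprVn.
  apply: soft_O_exp (@soft_O_sample_size R) => eps /andP[eps_gt0 eps_lt1].
  by rewrite invf_ge1 // ltW.
move=> eps eps01 n; split=> [|f ocf_f|f far].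
- exact: query_complexity_le.
- by apply: Pr_predT (card_seed_gt0 _ _) _ => alpha; apply: edge_accepts_OCF.
rewrite (Pr_predC R _ (card_seed_gt0 _ _)).
by have := Pr_edge_accepts_eps_far eps01 far; lra.
Qed.
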